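(* Let $p\colon\mathbb{E}\to\mathbb{B}$ be a locally small fibration where $\mathbb{B}$ has finite limits, and let $(m,n)$ and $(f,g)$ be families of squares. Then the following are equivalent. (1) Every family of lifting problems from $(m,n)$ to $(f,g)$ has a solution. (2) The universal family of lifting problems from $(m,n)$ to $(f,g)$ has a solution. (3) There is a coherent choice of solutions to all families of lifting problems from $(m,n)$ to $(f,g)$.
   Context: $p$ is a cloven Grothendieck fibration with reindexing $\sigma^*$. Vertical maps are those sent by $p$ to identities; $\mathbb{E}_I$ is the fibre over $I$; $V(\mathbb{E})$ is the full subcategory of $\mathbb{E}^{\mathbf 2}$ on vertical maps, fibred over $\mathbb{B}$ with levelwise reindexing. $p$ is locally small if for all $X,Y\in\mathbb{E}_I$ the functor $(u\colon J\to I)\mapsto\mathbb{E}_J(u^*X,u^*Y)$ on $(\mathbb{B}/I)^{op}$ is representable. A family of squares over $I\in\mathbb{B}$ is a commutative square in $\mathbb{E}_I$, i.e. a vertical map of $V(\mathbb{E})$. Write $(m,n)$ for a family of squares over $I$ with left side $m\colon U_0\to V_0$, right side $n\colon U_1\to V_1$ and horizontal maps $U_0\to U_1$, $V_0\to V_1$; and $(f,g)$ for one over $J$ with left side $f\colon X_0\to Y_0$, right side $g\colon X_1\to Y_1$ and horizontal maps $X_0\to X_1$, $Y_0\to Y_1$. A family of lifting problems from $(m,n)$ to $(f,g)$ over $K$ consists of $\sigma\colon K\to I$, $\tau\colon K\to J$ and a commutative square in $\mathbb{E}_K$ from $\sigma^*(n)$ to $\tau^*(f)$ (a map $\sigma^*(n)\to\tau^*(f)$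 in $V(\mathbb{E})_K$). Placing the squares side by side gives a commutative rectangle with left side $\sigma^*(m)$ and right side $\tau^*(g)$. A solution is a map $\sigma^*(V_0)\to\tau^*(X_1)$ in $\mathbb{E}_K$ making both triangles in this outer rectangle commute: its composite with $\sigma^*(m)$ is the top composite $\sigma^*(U_0)\to\tau^*(X_1)$, and its composite with $\tau^*(g)$ is the bottom composite $\sigma^*(V_0)\to\tau^*(Y_1)$. A map $k\colon K'\to K$ takes a family over $K$ to a family over $K'$ (with $\sigma k$, $\tau k$) by applying $k^*$. A coherent choice of solutions is a choice of solution for each family such that, for each $k\colon K'\to K$ and each family over $K$, the solution chosen for the induced family over $K'$ is $k^*$ of the one chosen over $K$. A family of lifting problems from $(m,n)$ to $(f,g)$ is universal if it is universal as a family of lifting problems from $n$ to $f$: every family over any $K'$ is obtained from it by applying $t^*$ for a unique map $t$ from $K'$ to its indexing object. (It exists when $p$ is locally small and $\mathbb{B}$ has finite limits.) *)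

(* Defs.v *)
From Stdlib Require Import ssreflect FinFun FunctionalExtensionality
  ProofIrrelevance IndefiniteDescription.

Set Implicit Arguments.
Unset Strict Implicit.
Unset Printing Implicit Defensive.

Declare Scope cat_scope.
Local Open Scope cat_scope.

Definition the (A : Type) (P : A -> Prop) (H : exists! x, P x) : A :=
  proj1_sig (constructive_definite_description P H).

Lemma theP (A : Type) (P : A -> Prop) (H : exists! x, P x) : P (the H).
Proof. exact: proj2_sig. Qed.

Record category := Category {
  obj :> Type;
  hom : obj -> obj -> Type;
  id : forall a, hom a a;
  comp : forall a b c, hom b c -> hom a b -> hom a c;
  comp_assoc : forall a b c d (h : hom c d) (g : hom b c) (f : hom a b),
    comp h (comp g f) = comp (comp h g) f;
  id_left : forall a b (f : hom a b), comp (id b) f = f;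
  id_right : forall a b (f : hom a b), comp f (id a) = f }.

Arguments hom {C} _ _ : rename.
Arguments id {C} a : rename.
Arguments comp {C a b c} _ _ : rename.
Notation "g ∘ f" := (comp g f) (at level 40, left associativity) : cat_scope.

Definition is_iso (C : category) (a b : C) (f : hom a b) : Prop :=
  exists g : hom b a, g ∘ f = id a /\ f ∘ g = id b.

Record functor (C D : category) := Functor {
  fob :> C -> D;
  fmap : forall a b, hom a b -> hom (fob a) (fob b);
  fmap_id : forall a, fmap (id a) = id (fob a);
  fmap_comp : forall a b c (g : hom b c) (f : hom a b),
    fmap (g ∘ f) = fmap g ∘ fmap f }.

Arguments fmap {C D} F {a b} _ : rename.

Record nat_trans (C D : category) (F G : functor C D) := NatTrans {
  component :> forall a, hom (F a) (G a);
  naturality : forall a b (f : hom a b),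
    component b ∘ fmap F f = fmap G f ∘ component a }.

Definition opposite (C : category) : category :=
  {| obj := C;
     hom := fun a b => @hom C b a;
     id := fun a => id a;
     comp := fun a b c g f => @comp C c b a f g;
     comp_assoc := fun a b c d h g f => eq_sym (@comp_assoc C d c b a f g h);
     id_left := fun a b f => @id_right C b a f;
     id_right := fun a b f => @id_left C b a f |}.

Definition TYPE : category :=
  {| obj := Type;
     hom := fun A B => A -> B;
     id := fun A x => x;
     comp := fun A B C g f x => g (f x);
     comp_assoc := fun A B C D h g f => eq_refl;
     id_left := fun A B f => eq_refl;
     id_right := fun A B f => eq_refl |}.

Definition hom_functor (C : category) (r : C) : functor (opposite C) TYPE.
Proof.
refine {| fob := fun a : opposite C => (@hom C a r : TYPE);
          fmap := fun (a b : opposite C) (f : @hom C b a) (x : @hom C a r) =>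
                    x ∘ f |}.
- by move=> a; apply: functional_extensionality => x; exact: id_right.
- by move=> a b c g f; apply: functional_extensionality => x; exact: comp_assoc.
Defined.

Definition representable (C : category) (F : functor (opposite C) TYPE) : Prop :=
  exists (r : C) (eta : nat_trans (hom_functor r) F), forall a, is_iso (eta a).

Record slice_obj (C : category) (I : C) := SliceObj {
  slice_dom : C;
  slice_map : hom slice_dom I }.

Record slice_hom (C : category) (I : C) (a b : slice_obj I) := SliceHom {
  slice_val : hom (slice_dom a) (slice_dom b);
  slice_comm : slice_map b ∘ slice_val = slice_map a }.

Lemma slice_hom_eq (C : category) (I : C) (a b : slice_obj I)
  (f g : slice_hom a b) : slice_val f = slice_val g -> f = g.
Proof.
case: f g => [f ef] [g eg] /= efg; move: efg ef eg => -> ef eg.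
by rewrite (proof_irrelevance _ ef eg).
Qed.

Definition slice (C : category) (I : C) : category.
Proof.
refine {| obj := slice_obj I;
          hom := @slice_hom C I;
          id := fun a => @SliceHom C I a a (id _) (id_right _);
          comp := fun a b c (g : slice_hom b c) (f : slice_hom a b) =>
            @SliceHom C I a c (slice_val g ∘ slice_val f) _ |}.
- by move=> a b c d h g f; apply: slice_hom_eq; exact: comp_assoc.
- by move=> a b f; apply: slice_hom_eq; exact: id_left.
- by move=> a b f; apply: slice_hom_eq; exact: id_right.
Unshelve.
by rewrite comp_assoc !slice_comm.
Defined.

Definition finite_category (S : category) : Prop :=
  Finite S /\ forall a b : S, Finite (hom a b).

Record cone (S C : category) (D : functor S C) := Cone {
  apex : C;
  leg : forall s, hom apex (D s);
  leg_comm : forall s t (f : hom s t), fmap D f ∘ leg s = leg t }.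

Definition is_limit (S C : category) (D : functor S C) (L : cone D) : Prop :=
  forall K : cone D, exists! h : hom (apex K) (apex L),
    forall s, leg L s ∘ h = leg K s.

Definition has_finite_limits (C : category) : Prop :=
  forall (S : category) (D : functor S C), finite_category S ->
    exists L : cone D, is_limit L.

Record arrow (C : category) := Arrow {
  dom : C;
  cod : C;
  arr : hom dom cod }.

(* A map [f -> g] of arrows is a commutative square with left side [f] and
   right side [g]. *)
Record square (C : category) (f g : arrow C) := Square {
  top : hom (dom f) (dom g);
  bot : hom (cod f) (cod g);
  square_comm : arr g ∘ top = bot ∘ arr f }.

Definition fmap_arrow (C D : category) (F : functor C D) (f : arrow C) : arrow D :=
  {| arr := fmap F (arr f) |}.

Definition cast_hom (C : category) (a a' b b' : C) (ea : a = a') (eb : b = b')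
    (f : hom a b) : hom a' b' :=
  match ea in _ = x, eb in _ = y return hom x y with
  | eq_refl, eq_refl => f
  end.

Section Fibration.

Variables (E B : category) (p : functor E B).

Record fibre_obj (I : B) := FibreObj {
  total : E;
  fibre_eq : p total = I }.

(* [over u f]: the map [f] of E lies over [u], i.e. [p f = u] up to the
   identifications of the endpoints. *)
Definition over (I J : B) (u : hom I J) (X : fibre_obj I) (Y : fibre_obj J)
    (f : hom (total X) (total Y)) : Prop :=
  cast_hom (fibre_eq X) (fibre_eq Y) (fmap p f) = u.

Lemma over_id (I : B) (X : fibre_obj I) : over (X := X) (Y := X) (id I) (id (total X)).
Proof. by case: X => X e; case: I / e; rewrite /over /= fmap_id. Qed.

Lemma over_comp (I J K : B) (v : hom J K) (u : hom I J) (X : fibre_obj I)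
    (Y : fibre_obj J) (Z : fibre_obj K) (g : hom (total Y) (total Z))
    (f : hom (total X) (total Y)) :
  over v g -> over u f -> over (X := X) (Y := Z) (v ∘ u) (g ∘ f).
Proof.
case: X f => X eX /= f; case: Y g f => Y eY /= g f; case: Z g => Z eZ /= g.
case: _ / eX u => u; case: _ / eY v u => v u; case: _ / eZ v => v.
by rewrite /over /= => <- <-; exact: fmap_comp.
Qed.

Record vertical (I : B) (X Y : fibre_obj I) := Vertical {
  vert :> hom (total X) (total Y);
  vert_over : over (id I) vert }.

Lemma vertical_eq (I : B) (X Y : fibre_obj I) (f g : vertical X Y) :
  vert f = vert g -> f = g.
Proof.
case: f g => [f ef] [g eg] /= efg; move: efg ef eg => -> ef eg.
by rewrite (proof_irrelevance _ ef eg).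
Qed.

Lemma over_precomp (I J : B) (u : hom I J) (X Y : fibre_obj I) (Z : fibre_obj J)
    (f : hom (total Y) (total Z)) (h : vertical X Y) :
  over u f -> over (X := X) (Y := Z) u (f ∘ vert h).
Proof. by move=> /over_comp /(_ (vert_over h)); rewrite id_right. Qed.

Lemma over_postcomp (I J : B) (u : hom I J) (X : fibre_obj I) (Y Z : fibre_obj J)
    (h : vertical Y Z) (f : hom (total X) (total Y)) :
  over u f -> over (X := X) (Y := Z) u (vert h ∘ f).
Proof. by move=> /(over_comp (vert_over h)); rewrite id_left. Qed.

Lemma vertical_comp_over (I : B) (X Y Z : fibre_obj I) (g : vertical Y Z)
    (f : vertical X Y) : over (X := X) (Y := Z) (id I) (vert g ∘ vert f).
Proof. exact: over_precomp (vert_over g). Qed.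

Definition fibre (I : B) : category.
Proof.
refine {| obj := fibre_obj I;
          hom := @vertical I;
          id := fun X => Vertical (over_id X);
          comp := fun X Y Z g f => Vertical (vertical_comp_over g f) |}.
- by move=> a b c d h g f; apply: vertical_eq; exact: comp_assoc.
- by move=> a b f; apply: vertical_eq; exact: id_left.
- by move=> a b f; apply: vertical_eq; exact: id_right.
Defined.

Definition cartesian (X Y : E) (f : hom X Y) : Prop :=
  forall (Z : E) (g : hom Z Y) (w : hom (p Z) (p X)), fmap p f ∘ w = fmap p g ->
    exists! h : hom Z X, fmap p h = w /\ f ∘ h = g.

Record cleavage := Cleavage {
  pull : forall I J (u : hom J I), fibre_obj I -> fibre_obj J;
  lift : forall I J (u : hom J I) (X : fibre_obj I),
    hom (total (pull u X)) (total X);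
  lift_over : forall I J (u : hom J I) (X : fibre_obj I), over u (lift u X);
  lift_cartesian : forall I J (u : hom J I) (X : fibre_obj I),
    cartesian (lift u X) }.

Arguments pull c {I J} u X : rename.
Arguments lift c {I J} u X : rename.
Arguments lift_over c {I J} u X : rename.
Arguments lift_cartesian c {I J} u X : rename.

Lemma cartesian_factor (I J K : B) (u : hom J I) (v : hom K J) (X : fibre_obj I)
    (Y : fibre_obj J) (Z : fibre_obj K) (f : hom (total Y) (total X))
    (g : hom (total Z) (total X)) :
  cartesian f -> over u f -> over (u ∘ v) g ->
  exists! h : hom (total Z) (total Y), over v h /\ f ∘ h = g.
Proof.
case: X f g => X eX /= f g; case: Y f => Y eY /= f; case: Z g => Z eZ /= g.
case: _ / eX u => u; case: _ / eY v u => v u; case: _ / eZ v => v.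
by rewrite /over /= => cf <- eg; apply: cf.
Qed.

Section Reindexing.

Variable c : cleavage.

Lemma lift_factor_ex (I J : B) (u : hom J I) (X : fibre_obj I) (Z : fibre_obj J)
    (g : hom (total Z) (total X)) :
  over u g ->
  exists! h : vertical Z (pull c u X), lift c u X ∘ vert h = g.
Proof.
move=> og; rewrite -(id_right u) in og.
have [h [[oh eh] hU]] := cartesian_factor (lift_cartesian c u X) (lift_over c u X) og.
exists (Vertical oh); split=> // k ek; apply: vertical_eq; apply: hU.
by split=> //; exact: vert_over.
Qed.

Definition lift_factor (I J : B) (u : hom J I) (X : fibre_obj I) (Z : fibre_obj J)
    (g : hom (total Z) (total X)) (og : over u g) : vertical Z (pull c u X) :=
  the (lift_factor_ex og).

Lemma lift_factorE (I J : B) (u : hom J I) (X : fibre_obj I) (Z : fibre_obj J)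
    (g : hom (total Z) (total X)) (og : over u g) :
  lift c u X ∘ vert (lift_factor og) = g.
Proof. exact: (theP (lift_factor_ex og)). Qed.

Lemma lift_inj (I J : B) (u : hom J I) (X : fibre_obj I) (Z : fibre_obj J)
    (h k : vertical Z (pull c u X)) :
  lift c u X ∘ vert h = lift c u X ∘ vert k -> h = k.
Proof.
move=> e; have oh : over (X := Z) u (lift c u X ∘ vert h).
  apply: over_precomp; exact: lift_over.
have [x [_ xU]] := lift_factor_ex oh.
by rewrite -(xU h) // -(xU k).
Qed.

Lemma over_vert_lift (I J : B) (u : hom J I) (X Y : fibre_obj I) (h : vertical X Y) :
  over u (vert h ∘ lift c u X).
Proof. apply: over_postcomp; exact: lift_over. Qed.

Definition reindex (I J : B) (u : hom J I) : functor (fibre I) (fibre J).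
Proof.
refine {| fob := (pull c u : fibre I -> fibre J);
          fmap := fun (X Y : fibre I) (h : vertical X Y) =>
                    (lift_factor (over_vert_lift u h)
                      : @hom (fibre J) (pull c u X) (pull c u Y)) |}.
- by move=> X; apply: lift_inj; rewrite lift_factorE /= id_left id_right.
- move=> X Y Z g f; apply: lift_inj.
  by rewrite lift_factorE /= comp_assoc lift_factorE -!comp_assoc lift_factorE.
Defined.

Lemma over_lift_lift (I J K : B) (u : hom J I) (v : hom K J) (w : hom K I)
    (e : u ∘ v = w) (X : fibre_obj I) :
  over w (lift c u X ∘ lift c v (pull c u X)).
Proof. by rewrite -e; apply: over_comp; exact: lift_over. Qed.

(* The canonical isomorphism from [v^*u^*X] to [w^*X], where [w = uv]; a
   cleavage need not be split, so that it is not an identity in general. *)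
Definition join (I J K : B) (u : hom J I) (v : hom K J) (w : hom K I)
    (e : u ∘ v = w) (X : fibre_obj I) :
    @hom (fibre K) (reindex v (reindex u X)) (reindex w X) :=
  lift_factor (over_lift_lift e X).

Lemma joinE (I J K : B) (u : hom J I) (v : hom K J) (w : hom K I)
    (e : u ∘ v = w) (X : fibre_obj I) :
  lift c w X ∘ vert (join e X) = lift c u X ∘ lift c v (pull c u X).
Proof. exact: lift_factorE. Qed.

Lemma split_ex (I J K : B) (u : hom J I) (v : hom K J) (w : hom K I)
    (e : u ∘ v = w) (X : fibre_obj I) :
  exists! s : @hom (fibre K) (reindex w X) (reindex v (reindex u X)),
    s ∘ join e X = id _ /\ join e X ∘ s = id _.
Proof.
have ow : over (u ∘ v) (lift c w X) by rewrite e; exact: lift_over.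
have [h [[oh eh] _]] := cartesian_factor (lift_cartesian c u X) (lift_over c u X) ow.
have js : join e X ∘ (lift_factor oh : hom (C := fibre K) _ _) = id _.
  by apply: lift_inj; rewrite /= comp_assoc joinE -comp_assoc lift_factorE eh id_right.
have sj : (lift_factor oh : hom (C := fibre K) _ _) ∘ join e X = id _.
{ apply: lift_inj; rewrite /= comp_assoc lift_factorE id_right.
  have oj : over (u ∘ v) (lift c w X ∘ vert (join e X)).
    by rewrite joinE; apply: over_comp; exact: lift_over.
  have [k [_ kU]] :=
    cartesian_factor (lift_cartesian c u X) (lift_over c u X) oj.
  transitivity k; first symmetry; apply: kU; split.
  - exact: over_precomp oh.
  - by rewrite comp_assoc eh.
  - exact: lift_over.
  - by rewrite joinE. }
exists (lift_factor oh); split=> // s [s_j _].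
by rewrite -[RHS]id_right -js comp_assoc s_j id_left.
Qed.

Definition split (I J K : B) (u : hom J I) (v : hom K J) (w : hom K I)
    (e : u ∘ v = w) (X : fibre_obj I) :
    @hom (fibre K) (reindex w X) (reindex v (reindex u X)) :=
  the (split_ex e X).

Lemma joinK (I J K : B) (u : hom J I) (v : hom K J) (w : hom K I)
    (e : u ∘ v = w) (X : fibre_obj I) : split e X ∘ join e X = id _.
Proof. by have [] := theP (split_ex e X). Qed.

Lemma splitK (I J K : B) (u : hom J I) (v : hom K J) (w : hom K I)
    (e : u ∘ v = w) (X : fibre_obj I) : join e X ∘ split e X = id _.
Proof. by have [] := theP (split_ex e X). Qed.

(* Reindexing along [v] of a map [u1^*X -> u2^*Y], regarded as a map
   [w1^*X -> w2^*Y] through the canonical isomorphisms, where [wi = ui v]. *)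
Definition base_change (I1 I2 J K : B) (u1 : hom J I1) (u2 : hom J I2)
    (v : hom K J) (w1 : hom K I1) (w2 : hom K I2)
    (e1 : u1 ∘ v = w1) (e2 : u2 ∘ v = w2) (X : fibre I1) (Y : fibre I2)
    (h : hom (reindex u1 X) (reindex u2 Y)) : hom (reindex w1 X) (reindex w2 Y) :=
  join e2 Y ∘ (fmap (reindex v) h ∘ split e1 X).

Lemma base_changeE (I1 I2 J K : B) (u1 : hom J I1) (u2 : hom J I2)
    (v : hom K J) (w1 : hom K I1) (w2 : hom K I2)
    (e1 : u1 ∘ v = w1) (e2 : u2 ∘ v = w2) (X : fibre I1) (Y : fibre I2)
    (h : hom (reindex u1 X) (reindex u2 Y)) :
  lift c w2 Y ∘ (vert (base_change e1 e2 h) ∘ vert (join e1 X)) =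
  lift c u2 Y ∘ (vert h ∘ lift c v (pull c u1 X)).
Proof.
have -> : vert (base_change e1 e2 h) ∘ vert (join e1 X) =
    vert (base_change e1 e2 h ∘ join e1 X) by [].
rewrite /base_change -!comp_assoc joinK id_right /=.
by rewrite comp_assoc joinE -comp_assoc lift_factorE.
Qed.

Lemma base_change_eq (I1 I2 J K : B) (u1 : hom J I1) (u2 : hom J I2)
    (v : hom K J) (w1 : hom K I1) (w2 : hom K I2)
    (e1 : u1 ∘ v = w1) (e2 : u2 ∘ v = w2) (X : fibre I1) (Y : fibre I2)
    (h : hom (reindex u1 X) (reindex u2 Y))
    (k : hom (reindex w1 X) (reindex w2 Y)) :
  lift c w2 Y ∘ (vert k ∘ vert (join e1 X)) =
    lift c u2 Y ∘ (vert h ∘ lift c v (pull c u1 X)) ->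
  base_change e1 e2 h = k.
Proof.
move=> ek; have ekj : base_change e1 e2 h ∘ join e1 X = k ∘ join e1 X.
  by apply: lift_inj; rewrite [LHS]base_changeE -ek.
by rewrite -[LHS]id_right -[RHS]id_right -(splitK e1 X) !comp_assoc ekj.
Qed.

Lemma base_change_id (J I1 I2 : B) (u1 : hom J I1) (u2 : hom J I2)
    (e1 : u1 ∘ id J = u1) (e2 : u2 ∘ id J = u2) (X : fibre I1) (Y : fibre I2)
    (h : hom (reindex u1 X) (reindex u2 Y)) :
  base_change e1 e2 h = h.
Proof.
apply: base_change_eq; congr (_ ∘ (_ ∘ _)).
have -> : join e1 X = Vertical (lift_over c (id J) (pull c u1 X)).
  by apply: lift_inj; rewrite joinE.
by [].
Qed.

Lemma base_change_base_change (I1 I2 J K L : B) (u1 : hom J I1) (u2 : hom J I2)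
    (v : hom K J) (w1 : hom K I1) (w2 : hom K I2)
    (v' : hom L K) (z1 : hom L I1) (z2 : hom L I2)
    (e1 : u1 ∘ v = w1) (e2 : u2 ∘ v = w2)
    (e1' : w1 ∘ v' = z1) (e2' : w2 ∘ v' = z2)
    (d1 : u1 ∘ (v ∘ v') = z1) (d2 : u2 ∘ (v ∘ v') = z2)
    (X : fibre I1) (Y : fibre I2)
    (h : hom (reindex u1 X) (reindex u2 Y)) :
  base_change d1 d2 h = base_change e1' e2' (base_change e1 e2 h).
Proof.
set bb := RHS; set j := join (eq_refl (v ∘ v')) (reindex u1 X).
apply: base_change_eq.
have jj : join d1 X ∘ j = join e1' X ∘ fmap (reindex v') (join e1 X).
  apply: lift_inj; rewrite /= !comp_assoc !joinE -!comp_assoc joinE.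
  by rewrite lift_factorE !comp_assoc joinE.
have oL : over z2 (lift c u2 Y ∘ (vert h ∘ lift c (v ∘ v') (pull c u1 X))).
  rewrite -d2; apply: over_comp; first exact: lift_over.
  exact: over_vert_lift.
have -> : lift c z2 Y ∘ (vert bb ∘ vert (join d1 X)) =
    lift c z2 Y ∘ vert (bb ∘ join d1 X) by [].
pose q : @hom (fibre L) (reindex (v ∘ v') (reindex u1 X)) (reindex z2 Y) :=
  lift_factor oL.
rewrite -(lift_factorE oL : _ ∘ vert q = _).
suff -> : bb ∘ join d1 X = q by [].
rewrite -[LHS]id_right -[RHS]id_right -(splitK (eq_refl (v ∘ v')) (reindex u1 X)) -/j.
rewrite !comp_assoc; congr (_ ∘ _).
apply: lift_inj.
have -> : bb ∘ join d1 X ∘ j = bb ∘ join e1' X ∘ fmap (reindex v') (join e1 X).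
  by rewrite -comp_assoc jj comp_assoc.
transitivity (lift c z2 Y ∘ (vert bb ∘ vert (join e1' X)) ∘
    vert (fmap (reindex v') (join e1 X))).
  by rewrite !comp_assoc.
rewrite base_changeE -!comp_assoc lift_factorE.
transitivity (lift c z2 Y ∘ vert q ∘ vert j); last by rewrite comp_assoc.
rewrite lift_factorE -!comp_assoc joinE !comp_assoc; congr (_ ∘ _).
by have := base_changeE e1 e2 h; rewrite !comp_assoc.
Qed.

Lemma base_change_comp (I1 I2 I3 J K : B) (u1 : hom J I1) (u2 : hom J I2)
    (u3 : hom J I3) (v : hom K J) (w1 : hom K I1) (w2 : hom K I2) (w3 : hom K I3)
    (e1 : u1 ∘ v = w1) (e2 : u2 ∘ v = w2) (e3 : u3 ∘ v = w3)
    (X : fibre I1) (Y : fibre I2) (Z : fibre I3)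
    (g : hom (reindex u2 Y) (reindex u3 Z)) (f : hom (reindex u1 X) (reindex u2 Y)) :
  base_change e1 e3 (g ∘ f) = base_change e2 e3 g ∘ base_change e1 e2 f.
Proof.
rewrite /base_change fmap_comp -!comp_assoc; do 2 congr (_ ∘ _).
by rewrite [split e2 Y ∘ _]comp_assoc joinK id_left.
Qed.

Lemma base_change_fmap (I J K : B) (u : hom J I) (v : hom K J) (w : hom K I)
    (e : u ∘ v = w) (X Y : fibre I) (f : hom X Y) :
  base_change e e (fmap (reindex u) f) = fmap (reindex w) f.
Proof.
apply: base_change_eq; rewrite /= !comp_assoc !lift_factorE.
by rewrite -!comp_assoc joinE.
Qed.

(* The presheaf [(u : J -> I) |-> E_J(u^*X, u^*Y)] on [B/I]. *)
Definition fibre_hom_functor (I : B) (X Y : fibre I) :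
  functor (opposite (slice I)) TYPE.
Proof.
refine {| fob := fun a : opposite (slice I) =>
            (@hom (fibre (slice_dom a)) (reindex (slice_map a) X)
                                        (reindex (slice_map a) Y) : TYPE);
          fmap := fun (a b : opposite (slice I)) (s : @hom (slice I) b a) h =>
            base_change (slice_comm s) (slice_comm s) h |}.
- by move=> a; apply: functional_extensionality => h; exact: base_change_id.
- move=> a b d g f; apply: functional_extensionality => h.
  exact: base_change_base_change.
Defined.

Definition locally_small : Prop :=
  forall (I : B) (X Y : fibre I), representable (fibre_hom_functor X Y).

Section Lifting.

Variables (I J : B) (m n : arrow (fibre I)) (mn : square m n)
  (f g : arrow (fibre J)) (fg : square f g).

(* Only the right side [n] of [mn] and the left side [f] of [fg] enter the
   problem; the rest of the two squares enters its solutions. *)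
Record lifting_family (K : B) := LiftingFamily {
  lf_left : hom K I;
  lf_right : hom K J;
  lf_square : square (fmap_arrow (reindex lf_left) n)
                     (fmap_arrow (reindex lf_right) f) }.

Lemma restrict_comm (K K' : B) (k : hom K' K) (F : lifting_family K) :
  let s := lf_left F in let t := lf_right F in
  fmap (reindex (t ∘ k)) (arr f) ∘
    base_change eq_refl eq_refl (top (lf_square F)) =
  base_change eq_refl eq_refl (bot (lf_square F)) ∘
    fmap (reindex (s ∘ k)) (arr n).
Proof.
move=> s t.
rewrite -(base_change_fmap (eq_refl (t ∘ k))) -(base_change_fmap (eq_refl (s ∘ k))).
rewrite -!base_change_comp.
by rewrite (square_comm (lf_square F)).
Qed.

Definition restrict (K K' : B) (k : hom K' K) (F : lifting_family K) :
    lifting_family K' :=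
  {| lf_left := lf_left F ∘ k;
     lf_right := lf_right F ∘ k;
     lf_square :=
       @Square _ (fmap_arrow (reindex (lf_left F ∘ k)) n)
                 (fmap_arrow (reindex (lf_right F ∘ k)) f)
                 _ _ (restrict_comm k F) |}.

Definition universal (K : B) (F : lifting_family K) : Prop :=
  forall (K' : B) (F' : lifting_family K'), exists! t : hom K' K, restrict t F = F'.

Record solution (K : B) (F : lifting_family K) := Solution {
  diag : hom (reindex (lf_left F) (cod m)) (reindex (lf_right F) (dom g));
  diag_top : diag ∘ fmap (reindex (lf_left F)) (arr m) =
    fmap (reindex (lf_right F)) (top fg) ∘
      (top (lf_square F) ∘ fmap (reindex (lf_left F)) (top mn));
  diag_bot : fmap (reindex (lf_right F)) (arr g) ∘ diag =
    fmap (reindex (lf_right F)) (bot fg) ∘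
      (bot (lf_square F) ∘ fmap (reindex (lf_left F)) (bot mn)) }.

Definition has_solution (K : B) (F : lifting_family K) : Prop :=
  inhabited (solution F).

Definition all_have_solutions : Prop :=
  forall (K : B) (F : lifting_family K), has_solution F.

Definition coherent (sol : forall K (F : lifting_family K), solution F) : Prop :=
  forall (K K' : B) (k : hom K' K) (F : lifting_family K),
    diag (sol K' (restrict k F)) = base_change eq_refl eq_refl (diag (sol K F)).

Definition has_coherent_choice : Prop :=
  exists sol : forall K (F : lifting_family K), solution F, coherent sol.

End Lifting.

End Reindexing.

End Fibration.

(* Main.v *)
(** A solution for the universal family restricts along the classifying map to
    a solution for any other family; since classifying maps compose, the
    solutions so obtained are coherent.  The universal family lives over the
    pullback of the objects classifying maps between the domains and maps
    between the codomains of [n] and [f], over the object classifying maps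
    from the domain of [n] to the codomain of [f]. *)
From Stdlib Require Import ssreflect FinFun ProofIrrelevance
  IndefiniteDescription List.
Require Import Defs.

Set Implicit Arguments.
Unset Strict Implicit.
Unset Printing Implicit Defensive.

Local Open Scope cat_scope.

(** * Finite preorders as shapes of diagrams *)

Section ThinCategory.

Variables (T : Type) (le : T -> T -> bool)
  (le_refl : forall a, le a a = true)
  (le_trans : forall a b c, le b c = true -> le a b = true -> le a c = true).

(** The order takes values in [bool], so that case analysis shows each hom-set to be empty or a
    singleton, hence finite. *)
Definition thin : category :=
  {| obj := T;
     hom := fun a b => le a b = true;
     id := le_refl;
     comp := le_trans;
     comp_assoc := fun a b c d h g f => proof_irrelevance _ _ _;
     id_left := fun a b f => proof_irrelevance _ _ _;
     id_right := fun a b f => proof_irrelevance _ _ _ |}.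

Lemma finite_thin : Finite T -> finite_category thin.
Proof.
move=> finT; split=> // a b; rewrite /thin /=.
case e: (le a b); last by exists nil => x; discriminate x.
by exists (eq_refl :: nil) => x; left; exact: proof_irrelevance.
Qed.

End ThinCategory.

Lemma finite_bool : Finite bool.
Proof. by exists (true :: false :: nil); case; rewrite /=; auto. Qed.

Lemma finite_option_bool : Finite (option bool).
Proof.
by exists (None :: Some true :: Some false :: nil); case=> [[]|]; rewrite /=; auto.
Qed.

(** With equality as the order the category is discrete, and limits over it are binary products. *)
Definition pair_shape : category.
Proof.
refine (@thin bool Bool.eqb _ _); first by case.
by case; case; case.
Defined.

(* [None] is the vertex of the cospan and [Some true], [Some false] its feet. *)
Definition cospan_le (a b : option bool) : bool :=
  match a, b with
  | _, None => true
  | Some x, Some y => Bool.eqb x y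
  | None, Some _ => false
  end.

Definition cospan_shape : category.
Proof.
refine (@thin (option bool) cospan_le _ _); first by case=> [[]|].
by case=> [[]|]; case=> [[]|]; case=> [[]|].
Defined.

(** * Binary products and pullbacks from finite limits *)

Section Limits.

Variable (B : category).

Definition pair_diagram (I J : B) : functor pair_shape B.
Proof.
unshelve refine {| fob := fun b : pair_shape => (if b then I else J) : B |}.
- by case; case=> //= _; exact: id.
- by case.
- by case; case; case=> //= *; rewrite id_left.
Defined.

Definition cospan_diagram (X Y Z : B) (a : hom X Z) (b : hom Y Z) :
  functor cospan_shape B.
Proof.
unshelve refine {| fob := fun s : cospan_shape =>
  match s with None => Z | Some true => X | Some false => Y end : B |}.
- case=> [[]|]; case=> [[]|] /= H; try discriminate H;
    [exact: id|exact: a|exact: id|exact: b|exact: id].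
- by case=> [[]|].
- by case=> [[]|]; case=> [[]|]; case=> [[]|] //= *; rewrite ?id_left ?id_right.
Defined.

Hypothesis fl : has_finite_limits B.

Lemma product_exists (I J : B) :
  exists (P : B) (p1 : hom P I) (p2 : hom P J),
    forall (K : B) (u1 : hom K I) (u2 : hom K J),
      exists! w : hom K P, p1 ∘ w = u1 /\ p2 ∘ w = u2.
Proof.
have [L limL] := fl (pair_diagram I J) (finite_thin _ _ finite_bool).
exists (apex L), (leg L true), (leg L false) => K u1 u2.
unshelve epose (C := @Cone pair_shape B (pair_diagram I J) K
  (fun s : bool => if s return hom K (if s then I else J) then u1 else u2) _).
  by case; case=> //= ?; rewrite id_left.
have [h [hE hU]] := limL C; exists h; split.
  by split; [exact: (hE true)|exact: (hE false)].
by move=> k [k1 k2]; apply: hU; case.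
Qed.

Lemma pullback_exists (X Y Z : B) (a : hom X Z) (b : hom Y Z) :
  exists (P : B) (p1 : hom P X) (p2 : hom P Y),
    a ∘ p1 = b ∘ p2 /\
    forall (K : B) (u1 : hom K X) (u2 : hom K Y), a ∘ u1 = b ∘ u2 ->
      exists! w : hom K P, p1 ∘ w = u1 /\ p2 ∘ w = u2.
Proof.
have [L limL] := fl (cospan_diagram a b) (finite_thin _ _ finite_option_bool).
have La := @leg_comm _ _ _ L (Some true) None eq_refl.
have Lb := @leg_comm _ _ _ L (Some false) None eq_refl.
exists (apex L), (leg L (Some true)), (leg L (Some false)).
split=> [|K u1 u2 e]; first exact: eq_trans La (eq_sym Lb).
unshelve epose (C := @Cone cospan_shape B (cospan_diagram a b) K
  (fun s : option bool =>
     match s return hom K (cospan_diagram a b s) with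
     | None => a ∘ u1 | Some true => u1 | Some false => u2 end) _).
  by case=> [[]|]; case=> [[]|] //= ?; rewrite ?id_left.
have [h [hE hU]] := limL C; exists h; split.
  by split; [exact: (hE (Some true))|exact: (hE (Some false))].
move=> k [k1 k2]; apply: hU; case=> [[]|] //=.
(* The leg at the vertex is determined by the one at the foot [Some true]. *)
by rewrite -La /= -k1 comp_assoc.
Qed.

End Limits.

(** * Coherence of the canonical isomorphisms, and objects classifying maps *)

Section Classifiers.

Variables (E B : category) (p : functor E B) (c : cleavage p).

(** Both sides followed by the cartesian lift of [z] give the composite of the lifts along [w], [v]
    and [u]. *)
Lemma join_assoc (I J K L : B) (u : hom J I) (v : hom K J) (w : hom L K)
    (uv : hom K I) (vw : hom L J) (z : hom L I)
    (e1 : u ∘ v = uv) (e2 : v ∘ w = vw) (e3 : u ∘ vw = z) (e4 : uv ∘ w = z)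
    (X : fibre p I) :
  join c e3 X ∘ join c e2 (reindex c u X) =
  join c e4 X ∘ fmap (reindex c w) (join c e1 X).
Proof.
apply: lift_inj; rewrite /= !comp_assoc !joinE -!comp_assoc joinE.
by rewrite lift_factorE !comp_assoc joinE.
Qed.

(** The left side is a right inverse, and the right side a left inverse, of the one map in
    [join_assoc]. *)
Lemma split_assoc (I J K L : B) (u : hom J I) (v : hom K J) (w : hom L K)
    (uv : hom K I) (vw : hom L J) (z : hom L I)
    (e1 : u ∘ v = uv) (e2 : v ∘ w = vw) (e3 : u ∘ vw = z) (e4 : uv ∘ w = z)
    (X : fibre p I) :
  split c e2 (reindex c u X) ∘ split c e3 X =
  fmap (reindex c w) (split c e1 X) ∘ split c e4 X.
Proof.
set s := LHS; set s' := RHS.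
have js : (join c e3 X ∘ join c e2 (reindex c u X)) ∘ s = id _.
  by rewrite /s -comp_assoc [join c e2 _ ∘ _]comp_assoc splitK id_left splitK.
have sj : s' ∘ (join c e4 X ∘ fmap (reindex c w) (join c e1 X)) = id _.
  rewrite /s' -comp_assoc [split c e4 _ ∘ _]comp_assoc joinK id_left.
  by rewrite -fmap_comp joinK fmap_id.
by rewrite -[RHS]id_right -js (join_assoc e1 e2 e3 e4) comp_assoc sj id_left.
Qed.

(** The types of the equations mention [v], so plain rewriting is blocked; substitution and proof
    irrelevance replace all of them together. *)
Lemma base_change_congr (I1 I2 J K : B) (u1 : hom J I1) (u2 : hom J I2)
    (v v' : hom K J) (w1 : hom K I1) (w2 : hom K I2)
    (e1 : u1 ∘ v = w1) (e2 : u2 ∘ v = w2)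
    (e1' : u1 ∘ v' = w1) (e2' : u2 ∘ v' = w2)
    (X : fibre p I1) (Y : fibre p I2)
    (h : hom (reindex c u1 X) (reindex c u2 Y)) :
  v = v' -> base_change e1 e2 h = base_change e1' e2' h.
Proof.
move=> ev; subst v'.
by rewrite (proof_irrelevance _ e1 e1') (proof_irrelevance _ e2 e2').
Qed.

(* A map of [E_K] between iterated reindexings, transported to the composite
   reindexings. *)
Definition flatten (I J P K : B) (p1 : hom P I) (p2 : hom P J) (w : hom K P)
    (u1 : hom K I) (u2 : hom K J) (e1 : p1 ∘ w = u1) (e2 : p2 ∘ w = u2)
    (X : fibre p I) (Y : fibre p J)
    (h : hom (reindex c w (reindex c p1 X)) (reindex c w (reindex c p2 Y))) :
    hom (reindex c u1 X) (reindex c u2 Y) :=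
  join c e2 Y ∘ (h ∘ split c e1 X).

Definition unflatten (I J P K : B) (p1 : hom P I) (p2 : hom P J) (w : hom K P)
    (u1 : hom K I) (u2 : hom K J) (e1 : p1 ∘ w = u1) (e2 : p2 ∘ w = u2)
    (X : fibre p I) (Y : fibre p J)
    (h : hom (reindex c u1 X) (reindex c u2 Y)) :
    hom (reindex c w (reindex c p1 X)) (reindex c w (reindex c p2 Y)) :=
  split c e2 Y ∘ (h ∘ join c e1 X).

Lemma unflattenK (I J P K : B) (p1 : hom P I) (p2 : hom P J) (w : hom K P)
    (u1 : hom K I) (u2 : hom K J) (e1 : p1 ∘ w = u1) (e2 : p2 ∘ w = u2)
    (X : fibre p I) (Y : fibre p J)
    (h : hom (reindex c u1 X) (reindex c u2 Y)) :
  flatten e1 e2 (unflatten e1 e2 h) = h.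
Proof.
rewrite /flatten /unflatten -!comp_assoc splitK id_right.
by rewrite comp_assoc splitK id_left.
Qed.

Lemma flattenK (I J P K : B) (p1 : hom P I) (p2 : hom P J) (w : hom K P)
    (u1 : hom K I) (u2 : hom K J) (e1 : p1 ∘ w = u1) (e2 : p2 ∘ w = u2)
    (X : fibre p I) (Y : fibre p J)
    (h : hom (reindex c w (reindex c p1 X)) (reindex c w (reindex c p2 Y))) :
  unflatten e1 e2 (flatten e1 e2 h) = h.
Proof.
rewrite /flatten /unflatten -!comp_assoc joinK id_right.
by rewrite comp_assoc joinK id_left.
Qed.

(** The two sides differ only in the bracketing of canonical isomorphisms, settled by [join_assoc]
    at the target and [split_assoc] at the source. *)
Lemma base_change_flatten (I J P K L : B) (p1 : hom P I) (p2 : hom P J)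
    (w : hom K P) (u1 : hom K I) (u2 : hom K J)
    (e1 : p1 ∘ w = u1) (e2 : p2 ∘ w = u2)
    (t : hom L K) (wt : hom L P) (e : w ∘ t = wt) (z1 : hom L I) (z2 : hom L J)
    (d1 : u1 ∘ t = z1) (d2 : u2 ∘ t = z2)
    (f1 : p1 ∘ wt = z1) (f2 : p2 ∘ wt = z2)
    (X : fibre p I) (Y : fibre p J)
    (h : hom (reindex c w (reindex c p1 X)) (reindex c w (reindex c p2 Y))) :
  base_change d1 d2 (flatten e1 e2 h) = flatten f1 f2 (base_change e e h).
Proof.
rewrite /base_change /flatten !fmap_comp !comp_assoc (join_assoc e2 e f2 d2).
by rewrite -!comp_assoc (split_assoc e1 e f1 d1).
Qed.

Hypotheses (ls : locally_small c) (fl : has_finite_limits B).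

(* Local smallness only compares objects of one fibre; for objects of
   different fibres one first passes to the product of the bases. *)
Lemma generic_hom (I J : B) (X : fibre p I) (Y : fibre p J) :
  exists (R : B) (r1 : hom R I) (r2 : hom R J)
      (h : hom (reindex c r1 X) (reindex c r2 Y)),
    forall (K : B) (u1 : hom K I) (u2 : hom K J)
        (k : hom (reindex c u1 X) (reindex c u2 Y)),
      exists! t : hom K R,
        exists (e1 : r1 ∘ t = u1) (e2 : r2 ∘ t = u2), base_change e1 e2 h = k.
Proof.
have [P [p1 [p2 prodP]]] := product_exists fl I J.
have [r [eta eta_iso]] := ls (reindex c p1 X) (reindex c p2 Y).
(* Yoneda: the image of the identity is the generic element, and by naturality every value of [eta]
   is a base change of it. *)
pose h0 := eta r (id r).
have etaE (a : slice P) (s : hom a r) :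
    eta a s = base_change (slice_comm s) (slice_comm s) h0.
  rewrite -[s in LHS]id_left.
  exact: (f_equal (fun F => F (id r)) (@naturality _ _ _ _ eta r a s)).
exists (slice_dom r), (p1 ∘ slice_map r), (p2 ∘ slice_map r).
exists (flatten eq_refl eq_refl h0) => K u1 u2 k.
have [w [[w1 w2] wU]] := prodP K u1 u2.
pose a : slice P := SliceObj w.
have [inv [invK Kinv]] := eta_iso a.
(* Seen over the product, [k] is an element of the represented presheaf at [w], so it corresponds to
   a map from [a] to [r] in the slice. *)
pose k0 := unflatten w1 w2 k.
have e0 : eta a (inv k0) = k0 by exact: (f_equal (fun F => F k0) Kinv).
pose s : hom a r := inv k0.
have es : slice_map r ∘ slice_val s = w := slice_comm s.
have d1 : p1 ∘ slice_map r ∘ slice_val s = u1 by rewrite -comp_assoc es.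
have d2 : p2 ∘ slice_map r ∘ slice_val s = u2 by rewrite -comp_assoc es.
exists (slice_val s); split.
  exists d1, d2; rewrite (base_change_flatten _ _ es _ _ w1 w2).
  rewrite -(unflattenK w1 w2 k); congr flatten.
  by rewrite -/k0 -e0 etaE; apply: base_change_congr.
move=> t [t1 [t2 tE]].
(* A competitor has the same two projections as [w], so it is also a map of the slice, and
   injectivity of [eta a] applies. *)
have et : slice_map r ∘ t = w.
  by symmetry; apply: wU; rewrite !comp_assoc.
pose s' : hom a r := @SliceHom _ _ a r t et.
suff -> : s = s' by [].
have -> : s' = inv (eta a s') by symmetry; exact: (f_equal (fun F => F s') invK).
rewrite /s; congr inv; rewrite etaE.
rewrite /k0 -tE (base_change_flatten _ _ et _ _ w1 w2) flattenK.
exact: base_change_congr.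
Qed.

End Classifiers.

(** * Restriction of families, the universal family and coherent solutions *)

Section LiftingFamilies.

Variables (E B : category) (p : functor E B) (c : cleavage p) (I J : B)
  (m n : arrow (fibre p I)) (mn : square m n)
  (f g : arrow (fibre p J)) (fg : square f g).

(** Equality of dependent records is traded for base changes along arbitrary equations, the form in
    which [generic_hom] characterises maps. *)
Lemma restrict_eqP (K K' : B) (k : hom K' K) (F : lifting_family c n f K)
    (F' : lifting_family c n f K') :
  restrict k F = F' <->
  exists (e1 : lf_left F ∘ k = lf_left F') (e2 : lf_right F ∘ k = lf_right F'),
    base_change e1 e2 (top (lf_square F)) = top (lf_square F') /\
    base_change e1 e2 (bot (lf_square F)) = bot (lf_square F').
Proof.
split=> [<-|]; first by exists eq_refl, eq_refl.
case: F' => s t [a b ab] /= [e1 [e2]]; subst s t; case=> ea eb; subst a b.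
rewrite /restrict; congr LiftingFamily.
by rewrite (proof_irrelevance _ (restrict_comm _ _) ab).
Qed.

Lemma restrict_restrict (K K' K'' : B) (k : hom K' K) (k' : hom K'' K')
    (F : lifting_family c n f K) :
  restrict (k ∘ k') F = restrict k' (restrict k F).
Proof.
apply/restrict_eqP; exists (comp_assoc _ _ _), (comp_assoc _ _ _).
by split; exact: base_change_base_change.
Qed.

(** Base change preserves composites and takes reindexed maps to reindexed maps, so it carries both
    triangles along. The diagonal is recorded for the sake of coherence. *)
Lemma base_change_solution (K K' : B) (k : hom K' K)
    (F : lifting_family c n f K) (s : solution mn fg F) :
  exists s' : solution mn fg (restrict k F),
    diag s' = base_change eq_refl eq_refl (diag s).
Proof.
have dt : base_change eq_refl eq_refl (diag s) ∘
      fmap (reindex c (lf_left F ∘ k)) (arr m) =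
    fmap (reindex c (lf_right F ∘ k)) (top fg) ∘
      (base_change eq_refl eq_refl (top (lf_square F)) ∘
        fmap (reindex c (lf_left F ∘ k)) (top mn)).
  rewrite -!(base_change_fmap c (eq_refl (lf_left F ∘ k))).
  rewrite -(base_change_fmap c (eq_refl (lf_right F ∘ k))) -!base_change_comp.
  by rewrite diag_top.
have db : fmap (reindex c (lf_right F ∘ k)) (arr g) ∘
      base_change eq_refl eq_refl (diag s) =
    fmap (reindex c (lf_right F ∘ k)) (bot fg) ∘
      (base_change eq_refl eq_refl (bot (lf_square F)) ∘
        fmap (reindex c (lf_left F ∘ k)) (bot mn)).
  rewrite -!(base_change_fmap c (eq_refl (lf_right F ∘ k))).
  rewrite -(base_change_fmap c (eq_refl (lf_left F ∘ k))) -!base_change_comp.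
  by rewrite diag_bot.
by exists (Solution (F := restrict k F) dt db).
Qed.

Lemma universal_family_exists :
  locally_small c -> has_finite_limits B ->
  exists (K : B) (U : lifting_family c n f K), universal U.
Proof.
move=> ls fl.
have [RT [t1 [t2 [hT TP]]]] := generic_hom ls fl (dom n) (dom f).
have [RB [b1 [b2 [hB BP]]]] := generic_hom ls fl (cod n) (cod f).
have [RD [d1 [d2 [hD DP]]]] := generic_hom ls fl (dom n) (cod f).
(* [a] and [b] classify the generic top map followed by [f] and [n] followed by the generic bottom
   map, each suitably reindexed. *)
have [a [[a1 [a2 aE]] _]] := DP _ _ _ (fmap (reindex c t2) (arr f) ∘ hT).
have [b [[b1' [b2' bE]] _]] := DP _ _ _ (hB ∘ fmap (reindex c b1) (arr n)).
have [K [qT [qB [eab PB]]]] := pullback_exists fl a b.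
(* On the pullback the top and bottom maps are indexed by the same maps to [I] and [J], because
   those of [RT] and [RB] factor through [RD]. *)
have l1 : b1 ∘ qB = t1 ∘ qT by rewrite -a1 -b1' -!comp_assoc eab.
have l2 : b2 ∘ qB = t2 ∘ qT by rewrite -a2 -b2' -!comp_assoc eab.
(* The two composites of the square to be formed are classified by [a ∘ x] and
   [b ∘ x], so that the square commutes iff these maps into [RD] agree. *)
have topE (L : B) (x : hom L RT) u1 u2 (e1 : t1 ∘ x = u1) (e2 : t2 ∘ x = u2)
    (z1 : d1 ∘ (a ∘ x) = u1) (z2 : d2 ∘ (a ∘ x) = u2) :
    fmap (reindex c u2) (arr f) ∘ base_change e1 e2 hT = base_change z1 z2 hD.
  rewrite -(base_change_fmap c e2) -base_change_comp -aE.
  by rewrite -base_change_base_change.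
have botE (L : B) (x : hom L RB) u1 u2 (e1 : b1 ∘ x = u1) (e2 : b2 ∘ x = u2)
    (z1 : d1 ∘ (b ∘ x) = u1) (z2 : d2 ∘ (b ∘ x) = u2) :
    base_change e1 e2 hB ∘ fmap (reindex c u1) (arr n) = base_change z1 z2 hD.
  rewrite -(base_change_fmap c e1) -base_change_comp -bE.
  by rewrite -base_change_base_change.
have comm : fmap (reindex c (t2 ∘ qT)) (arr f) ∘ base_change eq_refl eq_refl hT =
    base_change l1 l2 hB ∘ fmap (reindex c (t1 ∘ qT)) (arr n).
  have za1 : d1 ∘ (a ∘ qT) = t1 ∘ qT by rewrite comp_assoc a1.
  have za2 : d2 ∘ (a ∘ qT) = t2 ∘ qT by rewrite comp_assoc a2.
  have zb1 : d1 ∘ (b ∘ qB) = t1 ∘ qT by rewrite -eab.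
  have zb2 : d2 ∘ (b ∘ qB) = t2 ∘ qT by rewrite -eab.
  rewrite (topE _ _ _ _ _ _ za1 za2) (botE _ _ _ _ _ _ zb1 zb2).
  exact: base_change_congr.
exists K, (@LiftingFamily _ _ _ c _ _ n f K (t1 ∘ qT) (t2 ∘ qT)
  (@Square _ (fmap_arrow (reindex c (t1 ∘ qT)) n)
             (fmap_arrow (reindex c (t2 ∘ qT)) f) _ _ comm)).
move=> K' F'.
have [xT [[xT1 [xT2 xTE]] xTU]] := TP _ _ _ (top (lf_square F')).
have [xB [[xB1 [xB2 xBE]] xBU]] := BP _ _ _ (bot (lf_square F')).
have ex : a ∘ xT = b ∘ xB.
{ have za1 : d1 ∘ (a ∘ xT) = lf_left F' by rewrite comp_assoc a1.
  have za2 : d2 ∘ (a ∘ xT) = lf_right F' by rewrite comp_assoc a2.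
  have zb1 : d1 ∘ (b ∘ xB) = lf_left F' by rewrite comp_assoc b1'.
  have zb2 : d2 ∘ (b ∘ xB) = lf_right F' by rewrite comp_assoc b2'.
  (* Both [a ∘ xT] and [b ∘ xB] classify the common composite of the commutative square of [F'], so
     they agree by uniqueness. *)
  have [x [_ xU]] := DP _ _ _ (fmap (reindex c (lf_right F')) (arr f) ∘
    top (lf_square F') : hom (reindex c (lf_left F') (dom n)) _).
  transitivity x; [symmetry|]; apply: xU.
  - by exists za1, za2; rewrite -(topE _ _ _ _ xT1 xT2) xTE.
  - exists zb1, zb2; rewrite -(botE _ _ _ _ xB1 xB2) xBE.
    exact: (eq_sym (square_comm (lf_square F'))). }
have [t [[tT tB] tU]] := PB _ _ _ ex.
exists t; split.
{ apply/restrict_eqP.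
  have e1 : t1 ∘ qT ∘ t = lf_left F' by rewrite -comp_assoc tT.
  have e2 : t2 ∘ qT ∘ t = lf_right F' by rewrite -comp_assoc tT.
  have e1T : t1 ∘ (qT ∘ t) = lf_left F' by rewrite tT.
  have e2T : t2 ∘ (qT ∘ t) = lf_right F' by rewrite tT.
  have e1B : b1 ∘ (qB ∘ t) = lf_left F' by rewrite tB.
  have e2B : b2 ∘ (qB ∘ t) = lf_right F' by rewrite tB.
  exists e1, e2; split=> /=.
  - rewrite -(base_change_base_change _ _ _ _ e1T e2T) -xTE.
    exact: base_change_congr.
  - rewrite -(base_change_base_change _ _ _ _ e1B e2B) -xBE.
    exact: base_change_congr. }
(* The two components of [t'] classify the top and bottom maps of [F'], so they must be [xT] and
   [xB]. *)
move=> t' /restrict_eqP /= [e1 [e2 [eT eB]]]; apply: tU; split; symmetry.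
- have e1T : t1 ∘ (qT ∘ t') = lf_left F' by rewrite comp_assoc.
  have e2T : t2 ∘ (qT ∘ t') = lf_right F' by rewrite comp_assoc.
  apply: xTU; exists e1T, e2T; rewrite -eT.
  exact: base_change_base_change.
- have e1B : b1 ∘ (qB ∘ t') = lf_left F' by rewrite comp_assoc l1.
  have e2B : b2 ∘ (qB ∘ t') = lf_right F' by rewrite comp_assoc l2.
  apply: xBU; exists e1B, e2B; rewrite -eB.
  exact: base_change_base_change.
Qed.

Lemma coherent_choice_of_universal (K : B) (U : lifting_family c n f K) :
  universal U -> has_solution mn fg U -> has_coherent_choice c mn fg.
Proof.
move=> univ [sU].
(* The condition pins down the diagonal of [s], so any choice of [s] will do. Arbitrary [e1] and
   [e2] make it usable when [F] equals a restriction of [U] only propositionally. *)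
have ex (K' : B) (F : lifting_family c n f K') : exists s : solution mn fg F,
    forall (t : hom K' K) (e1 : lf_left U ∘ t = lf_left F)
      (e2 : lf_right U ∘ t = lf_right F),
      restrict t U = F -> diag s = base_change e1 e2 (diag sU).
  have [t [eF tU]] := univ _ F; subst F.
  have [s sE] := base_change_solution t sU.
  exists s => t' e1 e2 /tU ett; rewrite sE; exact: base_change_congr.
exists (fun K' F => proj1_sig (constructive_indefinite_description _ (ex K' F))).
move=> K1 K2 k F.
case: (constructive_indefinite_description _ _) => s' /= s'E.
case: (constructive_indefinite_description _ _) => s /= sE.
have [t [eF _]] := univ _ F; subst F.
rewrite (sE t eq_refl eq_refl) //.
(* If [t] classifies [F], then [t ∘ k] classifies the restriction of [F] along [k]. *)
rewrite (s'E (t ∘ k) (comp_assoc _ _ _) (comp_assoc _ _ _)).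
  exact: restrict_restrict.
exact: base_change_base_change.
Qed.

End LiftingFamilies.

(** Universality determines a family only up to isomorphism of its index, so the equivalences are
    proved for every universal family; the first part ensures that there is one. *)
Theorem proposition8p1p5
  (E B : category) (p : functor E B) (c : cleavage p)
  (p_locally_small : locally_small c) (B_finite_limits : has_finite_limits B)
  (I J : B)
  (m n : arrow (fibre p I)) (mn : square m n)
  (f g : arrow (fibre p J)) (fg : square f g) :
  (exists (K : B) (U : lifting_family c n f K), universal U) /\
  (forall (K : B) (U : lifting_family c n f K), universal U ->
     (all_have_solutions c mn fg <-> has_solution mn fg U) /\
     (has_solution mn fg U <-> has_coherent_choice c mn fg)).
Proof.
split; first exact: universal_family_exists.
move=> K U univ.
have choice := coherent_choice_of_universal univ (mn := mn) (fg := fg).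
split; split.
- by apply.
(* Solving all families goes through the coherent choice, with coherence forgotten. *)
- by move=> /choice [sol _] K' F; constructor; exact: sol.
- exact: choice.
- by move=> [sol _]; constructor; exact: sol.
Qed.
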